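(* Let $(N,+,\cdot)$ be a nilpotent commutative ring of order a power of a prime $p$. Let $D$ be a principal ideal domain in which $p$ is a prime element. Suppose that $N$ has a $D$-algebra structure, i.e. $(N,+)$ is a $D$-module with $d(xy)=x(dy)$ for all $d\in D$, $x,y\in N$. If $\mathrm{rank}_D N<p-1$, then the groups $1+N$ and $(N,+)$ are isomorphic.
   Context: $1+N$ denotes the multiplicative group of formal elements $1+x$ ($x\in N$) with product $(1+x)(1+y)=1+(x+y+xy)$; it is isomorphic to $N$ with the operation $x\circ y=x+y+xy$. A nilpotent ring is not assumed to have an identity. For a PID $D$ and a finite (torsion) $D$-module $M$, $\mathrm{rank}_D M$ denotes the number of summands in the (essentially unique) decomposition of $M$ as a direct sum of nonzero indecomposable cyclic $D$-modules. *)

(* Defs.v *)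
From HB Require Import structures.
From mathcomp Require Import all_boot all_order all_fingroup all_algebra.

Set Implicit Arguments.
Unset Strict Implicit.
Unset Printing Implicit Defensive.

Import GRing.Theory.
Local Open Scope ring_scope.

(* Ideals are Prop-valued, so that no decidability of membership is assumed. *)
Definition ideal (D : comNzRingType) (I : D -> Prop) : Prop :=
  [/\ I 0, forall x y, I x -> I y -> I (x + y) & forall a x, I x -> I (a * x)].

Definition principal_ideal_domain (D : idomainType) : Prop :=
  forall I : D -> Prop, ideal I ->
    exists a, forall x, I x <-> exists b, x = b * a.

Definition rdivides (D : comNzRingType) (a b : D) : Prop := exists c, b = c * a.

Definition prime_element (D : idomainType) (q : D) : Prop :=
  [/\ q != 0, q \isn't a GRing.unit
    & forall a b, rdivides q (a * b) -> rdivides q a \/ rdivides q b].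

Section ModuleRank.

Variables (D : comNzRingType) (M : finLmodType D).
Implicit Types A B C : {set M}.

Definition cyclic_submodule C : Prop :=
  exists e, forall x, x \in C <-> exists a : D, x = a *: e.

(* The zero module does not count as indecomposable. *)
Definition indecomposable C : Prop :=
  [/\ submod_closed C, C <> [set 0]
    & forall A B, submod_closed A -> submod_closed B ->
        C = [set a + b | a in A, b in B] -> A :&: B = [set 0] ->
        A = [set 0] \/ B = [set 0]].

Definition internal_direct_sum r (C : 'I_r -> {set M}) : Prop :=
  forall x : M, exists! f : {ffun 'I_r -> M},
    (forall i, f i \in C i) /\ x = \sum_(i < r) f i.

(* The rank as a relation: M is an internal direct sum of r nonzero
   indecomposable cyclic submodules. *)
Definition has_rank (r : nat) : Prop :=
  exists C : 'I_r -> {set M},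
    [/\ forall i, cyclic_submodule (C i), forall i, indecomposable (C i)
      & internal_direct_sum C].

End ModuleRank.

Arguments has_rank {D} M r.

(* The product is not the library's *%R, since the ring has no identity.
   nmul_nilp says N^(n+1) = 0 for some n: foldl nmul x s is the product of
   the n + 1 elements of x :: s. *)
HB.mixin Record Zmodule_isNilComRing N of GRing.Zmodule N := {
  nmul : N -> N -> N;
  nmulA : associative nmul;
  nmulC : commutative nmul;
  nmulDl : left_distributive nmul +%R;
  nmul_nilp : exists n, forall (x : N) (s : n.-tuple N), foldl nmul x s = 0
}.

#[short(type="finNilComRingType")]
HB.structure Definition FinNilComRing :=
  {N of Zmodule_isNilComRing N & GRing.Zmodule N & Finite N}.

HB.mixin Record isNilComAlgebra (D : comNzRingType) N
    of FinNilComRing N & GRing.Lmodule D N := {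
  nscalerAr : forall (d : D) (x y : N), d *: nmul x y = nmul x (d *: y)
}.

#[short(type="finNilComAlgType")]
HB.structure Definition FinNilComAlg (D : comNzRingType) :=
  {N of isNilComAlgebra D N & FinNilComRing N & GRing.Lmodule D N}.

Section OnePlus.

Variable N : finNilComRingType.
Implicit Types x y : N.

Lemma nmulDr : right_distributive (@nmul N) +%R.
Proof. by move=> x y z; rewrite ![nmul x _]nmulC nmulDl. Qed.

Lemma nmulr0 x : nmul x 0 = 0.
Proof. by apply: (addIr (nmul x 0)); rewrite -nmulDr !add0r. Qed.

Lemma nmul0r x : nmul 0 x = 0.
Proof. by rewrite nmulC nmulr0. Qed.

Lemma nmulNr x y : nmul (- x) y = - nmul x y.
Proof. by apply/eqP; rewrite -addr_eq0 -nmulDl addNr nmul0r. Qed.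

Lemma quasi_inverse_ex x : exists y, y + x + nmul y x = 0.
Proof.
have [n nilN] := nmul_nilp (s := N).
pose g := fix g k := if k is k'.+1 then - x + nmul (g k') (- x) else 0.
have foldE k z : foldl nmul z (nseq k (- x)) = iter k (@nmul N ^~ (- x)) z.
  by elim: k z => // k IHk z; rewrite iterSr -IHk.
have gS k : g k.+1 - g k = foldl nmul (- x) (nseq k (- x)).
  rewrite foldE; elim: k => [|k IHk]; first by rewrite /= nmul0r addr0 subr0.
  by rewrite iterS -IHk nmulDl nmulNr /= opprD addrACA subrr add0r.
have gn : g n.+1 = g n.
  by apply/eqP; rewrite -subr_eq0 gS (nilN _ (nseq_tuple n (- x))).
exists (g n).
rewrite -{1}gn /= [nmul _ (- x)]nmulC nmulNr [nmul x _]nmulC.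
by rewrite addrAC addrNK addNr.
Qed.

Inductive one_plus := OnePlus of N.
Bind Scope group_scope with one_plus.

Definition one_plus_val (u : one_plus) : N := let: OnePlus x := u in x.

HB.instance Definition _ := [isNew for one_plus_val].
HB.instance Definition _ := [Finite of one_plus by <:].

(* (1 + x)(1 + y) = 1 + (x + y + xy) *)
Definition one_plus_mul (u v : one_plus) : one_plus :=
  let: OnePlus x := u in let: OnePlus y := v in OnePlus (x + y + nmul x y).

Definition one_plus_one : one_plus := OnePlus 0.

(* The default value 0 is never reached, by quasi_inverse_ex. *)
Definition one_plus_inv (u : one_plus) : one_plus :=
  let: OnePlus x := u in
  OnePlus (odflt 0 [pick y | y + x + nmul y x == 0]).

Lemma one_plus_mulA : associative one_plus_mul.
Proof.
move=> [x] [y] [z] /=; congr OnePlus.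
rewrite !nmulDl !nmulDr nmulA -!addrA; do 2!congr (_ + _).
rewrite [RHS]addrCA; congr (_ + _).
by rewrite [LHS]addrCA; congr (_ + _); rewrite [LHS]addrCA.
Qed.

Lemma one_plus_mul1 : left_id one_plus_one one_plus_mul.
Proof. by case=> x; rewrite /= add0r nmul0r addr0. Qed.

Lemma one_plus_mulV : left_inverse one_plus_one one_plus_inv one_plus_mul.
Proof.
case=> x /=; case: pickP => [y /eqP -> // | no_y].
by have [y /eqP] := quasi_inverse_ex x; rewrite no_y.
Qed.

HB.instance Definition _ := Finite_isGroup.Build one_plus
  one_plus_mulA one_plus_mul1 one_plus_mulV.

End OnePlus.

(* Main.v *)
Require Import Defs.
From mathcomp Require Import all_boot all_order all_fingroup all_algebra.
From mathcomp Require Import all_solvable.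
From HB Require Import structures.

Set Implicit Arguments.
Unset Strict Implicit.
Unset Printing Implicit Defensive.

Import GRing.Theory.

(** Both groups are finite abelian p-groups on the same underlying set, so it
    is enough that 1 + x and x have the same order for every x: a finite
    abelian p-group is determined by the number of solutions of g ^ (p ^ n) = 1
    for each n ([isog_abelian_pgroup]).

    The key point is that x ^ (p - 1) lies in pN for every x
    ([iter_nmul_divisible]).  N is generated over D by r elements, one for each
    cyclic summand, so by Cayley-Hamilton multiplication by x satisfies a monic
    equation of degree r over D.  Let c_m be its lowest coefficient that does
    not map N into pN, so that m <= r.  This c_m is prime to p, hence
    invertible modulo p by Bezout; after dividing by it, the equation says that
    x ^ m (1 + t) maps N into pN for some t in N.  As t is nilpotent, 1 + t is
    bijective on N, so x ^ m N is contained in pN, and a fortiori x ^ r N is.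
    Since r <= p - 2, applying this to x itself gives x ^ (p - 1) in pN.

    Write now x ^ (p - 1) = p w.  In the binomial expansion of (1 + x) ^ p the
    middle coefficients are divisible by p and the last term x ^ p is p w x, so
    (1 + x) ^ p = 1 + p (x + t x) for some t in N ([one_plus_expp]).
    Multiplication by 1 + t is injective, so p ^ n kills x + t x exactly when
    it kills x, and the equality of orders follows by induction on the exponent
    ([one_plus_expp_eq1]). *)

(** * Finite abelian p-groups *)

(** The multiplicity of m + 1 is the number of entries > m minus the number of
    entries > m + 1; the multiplicity of 0 is not seen by these numbers. *)
Lemma perm_eq_count_gt (s t : seq nat) :
    0 \notin s -> 0 \notin t ->
    (forall n, count (fun m => n < m) s = count (fun m => n < m) t) ->
  perm_eq s t.
Proof.
move=> s0 t0 eq_st; rewrite /perm_eq; apply/allP=> -[|m] _ /=.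
  by rewrite (count_memPn s0) (count_memPn t0).
have split_gt u :
    count (fun k => m < k) u = count_mem m.+1 u + count (fun k => m.+1 < k) u.
  elim: u => //= k u ->.
  by rewrite addnACA; congr (_ + _); case: (ltngtP m.+1 k) => // <-; rewrite ltnn.
by move: (eq_st m); rewrite !split_gt eq_st => /addIn ->.
Qed.

Lemma card_Ohm_abelian_pgroup (gT : finGroupType) (G : {group gT}) (p n : nat) :
  abelian G -> (p.-group G)%g -> #|'Ohm_n(G)%g| = #|'Ldiv_(p ^ n)(G)%g|.
Proof.
by move=> cGG pG; rewrite (OhmEabelian pG) // (abelianS (Ohm_sub n G)).
Qed.

(** The number of cyclic factors of order > p ^ n is the logarithm of
    [|'Ohm_(n+1)| / |'Ohm_n|], and 'Ohm_n is the set of solutions of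
    g ^ (p ^ n) = 1; so the solution counts determine the multiset of orders of
    the cyclic factors, which is the abelian type. *)
Lemma isog_abelian_pgroup (aT rT : finGroupType)
    (G : {group aT}) (H : {group rT}) (p : nat) :
    prime p -> abelian G -> abelian H -> (p.-group G)%g -> (p.-group H)%g ->
    (forall n, #|'Ldiv_(p ^ n)(G)%g| = #|'Ldiv_(p ^ n)(H)%g|) ->
  (G \isog H)%g.
Proof.
move=> p_pr cGG cHH pG pH eqGH.
rewrite eq_abelian_type_isog //; apply/eqP.
apply: (sorted_eq (leT := geq)) => //.
- by move=> ? ? ? le1 le2; apply: leq_trans le2 le1.
- by move=> m n; rewrite /= andbC -eqn_leq => /eqP.
- exact: abelian_type_sorted.
- exact: abelian_type_sorted.
have exps gT (K : {group gT}) : abelian K -> (p.-group K)%g ->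
    exists s, [/\ abelian_type K = [seq p ^ i | i <- s], 0 \notin s
      & forall n, count (fun m => n < m) s
                  = logn p (#|'Ldiv_(p ^ n.+1)(K)%g| %/ #|'Ldiv_(p ^ n)(K)%g|)].
  move=> cKK pK; have [b defK eq_type] := abelian_structure cKK.
  exists [seq logn p #[x]%g | x <- b].
  have b_sub x : x \in b -> x \in K.
    move=> xb; rewrite -(bigdprodWY defK) mem_gen //.
    by rewrite (big_rem _ xb) /= inE cycle_id.
  have b_pow x : x \in b -> #[x]%g = p ^ logn p #[x]%g.
    move=> /b_sub Kx; have [i ->] := p_natP (mem_p_elt pK Kx).
    by rewrite pfactorK.
  split.
  - by rewrite -eq_type -map_comp; apply/eq_in_map=> x /b_pow.
  - apply/mapP=> -[x xb e0].
    have: #[x]%g \in abelian_type K by rewrite -eq_type map_f.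
    by move/(allP (abelian_type_gt1 K)); rewrite (b_pow x) //= -e0.
  move=> n; rewrite count_map -!card_Ohm_abelian_pgroup //.
  by rewrite divgS ?Ohm_leq // -(count_logn_dprod_cycle p n defK).
have [s [-> s0 cnt_s]] := exps _ _ cGG pG.
have [t [-> t0 cnt_t]] := exps _ _ cHH pH.
by apply/perm_map/perm_eq_count_gt => // n; rewrite cnt_s cnt_t !eqGH.
Qed.

Local Open Scope ring_scope.

(** * Multiplication in a nilpotent ring *)

Lemma nmul_is_zmod_morphism (N : finNilComRingType) (x : N) :
  zmod_morphism (nmul x).
Proof. by move=> y z; rewrite nmulDr (nmulC x (- z)) nmulNr (nmulC z). Qed.

HB.instance Definition _ (N : finNilComRingType) (x : N) :=
  GRing.isZmodMorphism.Build N N (nmul x) (nmul_is_zmod_morphism x).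

Lemma nmul_is_scalable (D : comNzRingType) (N : finNilComAlgType D) (x : N) :
  scalable (nmul x).
Proof. by move=> d y; rewrite nscalerAr. Qed.

HB.instance Definition _ (D : comNzRingType) (N : finNilComAlgType D) (x : N) :=
  GRing.isScalable.Build D N N *:%R (nmul x) (nmul_is_scalable x).

Lemma nmul_iterA (N : finNilComRingType) (x y z : N) n :
  nmul (iter n (nmul x) y) z = iter n (nmul x) (nmul y z).
Proof. by elim: n => //= n <-; rewrite nmulA. Qed.

Lemma iter_nmulMn (N : finNilComRingType) (x y : N) m n :
  iter m (nmul x) (y *+ n) = iter m (nmul x) y *+ n.
Proof. by elim: m => //= m ->; rewrite raddfMn. Qed.

(** 1 + x is invertible, so multiplication by it is injective on N, although
    the unit 1 itself is not in N; [addr_nmul_surj] is the surjectivity. *)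
Lemma addr_nmul_eq0 (N : finNilComRingType) (x y : N) :
  y + nmul x y = 0 -> y = 0.
Proof.
move=> y0; have [z xz] := quasi_inverse_ex x.
have zy0 : nmul z y + nmul z (nmul x y) = 0 by rewrite -nmulDr y0 nmulr0.
have : nmul (z + x + nmul z x) y = 0 by rewrite xz nmul0r.
by rewrite !nmulDl -nmulA addrAC zy0 add0r => xy0; move: y0; rewrite xy0 addr0.
Qed.

Lemma addr_nmul_surj (N : finNilComRingType) (x y : N) :
  exists z, z + nmul x z = y.
Proof.
have [z xz] := quasi_inverse_ex x; exists (y + nmul z y).
by rewrite nmulDr nmulA (nmulC x z) -addrA -!nmulDl addrA xz nmul0r addr0.
Qed.

(** * Divisibility of powers by p *)

Lemma iter_is_linear (D : comNzRingType) (M : lmodType D) n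
    (f : {linear M -> M}) :
  linear (iter n f).
Proof. by elim: n => [|n IHn] a y z //=; rewrite IHn linearP. Qed.

HB.instance Definition _ (D : comNzRingType) (M : lmodType D) n
    (f : {linear M -> M}) :=
  GRing.isLinear.Build D M M *:%R (iter n f) (iter_is_linear n f).

(** Cayley-Hamilton for a module that need not be free: if the matrix A
    expresses f on the generators, then q(f) is given on them by q(A) for every
    polynomial q, and the characteristic polynomial of A annihilates f. *)
Lemma endomorphism_integral (D : comNzRingType) (M : lmodType D) r
    (e : 'I_r -> M) (f : {linear M -> M}) :
    (forall y, exists a : 'I_r -> D, y = \sum_i a i *: e i) ->
  exists c : nat -> D,
    c r = 1 /\ forall y, \sum_(i < r.+1) c i *: iter i f y = 0.
Proof.
(* The matrix ring needs r > 0; for r = 0 the module is zero. *)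
case: r e => [|r] e span_e.
  exists (fun=> 1); split=> // y; have [a ->] := span_e y.
  by rewrite big_ord0 big_ord1 scale1r.
have [A defA] := fin_all_exists (fun i => span_e (f (e i))).
pose mA : 'M[D]_r.+1 := \matrix_(i, j) A i j.
have iterE n i : iter n f (e i) = \sum_j (mA ^+ n) i j *: e j.
  elim: n i => [|n IHn] i.
    rewrite (bigD1 i) //= !mxE eqxx scale1r big1 ?addr0 // => j ne_ji.
    by rewrite !mxE eq_sym (negPf ne_ji) scale0r.
  rewrite iterSr defA linear_sum.
  under eq_bigr do rewrite linearZ /= IHn scaler_sumr.
  rewrite exchange_big /=; apply: eq_bigr => k _.
  rewrite exprS mxE scaler_suml; apply: eq_bigr => j _.
  by rewrite !mxE scalerA.
have sz: size (char_poly mA) = r.+2 by rewrite size_char_poly.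
exists (fun i => (char_poly mA)`_i); split.
  by have /monicP := char_poly_monic mA; rewrite lead_coefE sz.
have annE i : \sum_(n < r.+2) (char_poly mA)`_n *: iter n f (e i) = 0.
  have := congr1 (horner_mx mA) (coefK (char_poly mA)).
  rewrite Cayley_Hamilton poly_def sz linear_sum.
  move=> /(congr1 (fun B : 'M_r.+1 => B i)) chi0.
  under eq_bigr do rewrite iterE scaler_sumr.
  rewrite exchange_big big1 //= => j _.
  under eq_bigr do rewrite scalerA.
  rewrite -scaler_suml -[RHS](scale0r (e j)); congr (_ *: _).
  have := congr1 (@^~ j) chi0; rewrite /= summxE [RHS]mxE; apply: etrans.
  by apply: eq_bigr => n _; rewrite linearZ /= rmorphXn /= horner_mx_X mxE.
move=> y; have [a ->] := span_e y.
under eq_bigr do rewrite linear_sum scaler_sumr.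
rewrite exchange_big big1 //= => i _.
under eq_bigr do rewrite linearZ /= scalerA mulrC -scalerA.
by rewrite -scaler_sumr annE scaler0.
Qed.

(** A generator g of the ideal (c, q) divides q = u g, so q divides u or g.
    If q divides u then g is a unit; if q divides g then it divides c. *)
Lemma prime_element_Bezout (D : idomainType) (q c : D) :
    principal_ideal_domain D -> prime_element q -> ~ rdivides q c ->
  exists a b, a * c + b * q = 1.
Proof.
move=> pidD [q0 _ q_pr] q'c.
have [|g defI] := pidD (fun z => exists a b, z = a * c + b * q).
  split=> [|_ _ [a1 [b1 ->]] [a2 [b2 ->]]|d _ [a [b ->]]].
  - by exists 0, 0; rewrite !mul0r addr0.
  - by exists (a1 + a2), (b1 + b2); rewrite !mulrDl addrACA.
  - by exists (d * a), (d * b); rewrite mulrDr !mulrA.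
have [|v defc] := (defI c).1; first by exists 1, 0; rewrite mul1r mul0r addr0.
have [|u defq] := (defI q).1; first by exists 0, 1; rewrite mul1r mul0r add0r.
have [|[w defw]|[w defw]] := q_pr u g; first by exists 1; rewrite mul1r.
  have wg1: w * g = 1.
    by apply: (mulIf q0); rewrite mul1r [RHS]defq defw mulrAC.
  by have [|a [b ab]] := (defI 1).2; [exists w | exists a, b].
by case: q'c; exists (v * w); rewrite defc defw mulrA.
Qed.

(** The number of generators bounds the nilpotency index of N / pN: among the
    coefficients of a monic equation for x of degree r, the lowest one that is
    nonzero modulo p is a unit modulo p, and all terms above it are multiples
    of its own term by elements of N. *)
Lemma iter_nmul_divisible (D : idomainType) (N : finNilComAlgType D) r p
    (e : 'I_r -> N) (x y : N) :
    principal_ideal_domain D -> prime_element (p%:R : D) ->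
    (forall z, exists a : 'I_r -> D, z = \sum_i a i *: e i) ->
  exists w, iter r (nmul x) y = w *+ p.
Proof.
move=> pidD p_pr span_e.
have [c [c_r ann_c]] := endomorphism_integral (nmul x) span_e.
pose pN z := [exists w : N, z == w *+ p].
have pNP z : reflect (exists w, z = w *+ p) (pN z) by apply: exists_eqP.
apply/pNP.
have pND z1 z2 : pN z1 -> pN z2 -> pN (z1 + z2).
  by move=> /pNP[w1 ->] /pNP[w2 ->]; apply/pNP; exists (w1 + w2); rewrite mulrnDl.
have pNZ d z : pN z -> pN (d *: z).
  by move=> /pNP[w ->]; apply/pNP; exists (d *: w); rewrite scalerMnr.
have pNx n z : pN z -> pN (iter n (nmul x) z).
  move=> /pNP[w ->]; apply/pNP; exists (iter n (nmul x) w).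
  by rewrite iter_nmulMn.
have pN0 : pN 0 by apply/pNP; exists 0; rewrite mul0rn.
have [/forallP N_pN|] := boolP [forall z, pN z]; first exact: N_pN.
(* [bad i] stands for p not dividing c i, but is decidable since N is finite. *)
move=> N'pN; pose bad i := ~~ [forall z, pN (c i *: z)].
have bad_r : bad r.
  by apply: contra N'pN => /forallP all_pN; apply/forallP => z;
    rewrite -[z]scale1r -c_r.
have [m bad_m min_m] := ex_minnP (ex_intro bad r bad_r).
have le_mr := min_m r bad_r.
have [a [b ab1]] : exists a b, a * c m + b * p%:R = 1.
  apply: prime_element_Bezout => // -[d defc]; case/negP: bad_m.
  apply/forallP=> z; apply/pNP; exists (d *: z).
  by rewrite defc -scalerA scaler_nat scalerMnr.
(* After division by c m, the terms above degree m add up to x ^ m * t; the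
   summand of degree i contributes x ^ (i - m). *)
pose t := \sum_(m.+1 <= i < r.+1) (a * c i) *: iter (i - m.+1) (nmul x) x.
have pN_unit z : pN (iter m (nmul x) (z + nmul t z)).
  have := ann_c z.
  rewrite -(big_mkord xpredT (fun i => c i *: iter i (nmul x) z)).
  rewrite (big_cat_nat _ (n := m)) //=; last exact: leqW.
  rewrite [X in _ + X]big_ltn ?ltnS //.
  set lo := \sum_(0 <= i < m) _; set hi := \sum_(m.+1 <= i < r.+1) _ => sum0.
  (* The terms below degree m lie in pN by minimality of m. *)
  have lo_pN : pN lo.
    rewrite /lo big_seq; apply: (big_ind pN) => // i.
    rewrite mem_index_iota => /andP[_ lt_im].
    have /negPn/forallP-> // : ~~ bad i.
    by apply: contraL lt_im => /min_m; rewrite leqNgt.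
  have tE : iter m (nmul x) (nmul t z) = a *: hi.
    rewrite /hi scaler_sumr nmulC !linear_sum; apply: eq_big_nat => i /andP[lt_mi _].
    rewrite 2!linearZ /= -scalerA nmulC nmul_iterA -iterSr -iterD.
    by rewrite addnS -addSn subnKC.
  have -> : iter m (nmul x) (z + nmul t z)
      = (- a) *: lo + b *: (iter m (nmul x) z *+ p).
    rewrite [iter m _ _]linearD /= tE; set z' := iter m _ z in sum0 *.
    have az : a *: hi = - (a *: lo) - (a * c m) *: z'.
      have: a *: lo + ((a * c m) *: z' + a *: hi) = 0.
        by rewrite -scalerA -!scalerDr sum0 scaler0.
      by move/eqP; rewrite addrA addrC addr_eq0 opprD => /eqP.
    rewrite -{1}[z']scale1r -ab1 scalerDl az -scaler_nat scalerA scaleNr.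
    by rewrite [LHS]addrC -addrA addKr.
  apply: pND; first exact: pNZ.
  by apply: pNZ; apply/pNP; exists (iter m (nmul x) z).
(* Every y has the form (1 + t) z, so x ^ m maps all of N into pN. *)
have [z <-] := addr_nmul_surj t y.
by rewrite -(subnK le_mr) iterD; apply: pNx.
Qed.

(** * Powers in the group 1 + N *)

(** The binomial formula: [iter j (nmul x) x] is x ^ (j + 1). *)
Lemma one_plus_expg (N : finNilComRingType) (x : N) n :
  (OnePlus x ^+ n)%g = OnePlus (\sum_(j < n) iter j (nmul x) x *+ 'C(n, j.+1)).
Proof.
elim: n => [|n IHn]; first by rewrite big_ord0.
rewrite expgS IHn; congr OnePlus.
rewrite raddf_sum [RHS](eq_bigr (fun j : 'I_n.+1 =>
  iter j (nmul x) x *+ 'C(n, j.+1) + iter j (nmul x) x *+ 'C(n, j))); last first.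
  by move=> j _; rewrite binS mulrnDr.
rewrite big_split /= big_ord_recr /= bin_small // mulr0n addr0.
rewrite [X in _ = _ + X]big_ord_recl /= bin0 mulr1n addrA (addrC x).
by congr (_ + _); apply: eq_bigr => j _; rewrite raddfMn.
Qed.

(** The hypothesis says x ^ (p - 1) = p w.  Hence x ^ p = p w x, and every term
    of the binomial formula after p x is p times a multiple of x. *)
Lemma one_plus_expp (N : finNilComRingType) (x w : N) p :
    prime p -> iter p.-2 (nmul x) x = w *+ p ->
  exists t, (OnePlus x ^+ p)%g = OnePlus ((x + nmul t x) *+ p).
Proof.
move=> p_pr; have := prime_gt1 p_pr; case: p p_pr => [|[|q]] //= p_pr _ xp.
exists (\sum_(j < q) iter j (nmul x) x *+ ('C(q.+2, j.+2) %/ q.+2) + w).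
rewrite one_plus_expg big_ord_recl big_ord_recr /= bin1 binn mulr1n; congr OnePlus.
rewrite xp raddfMn mulrnDl; congr (_ + _).
rewrite nmulDl mulrnDl; congr (_ + _ *+ _); last exact: nmulC.
rewrite [in RHS]nmulC raddf_sum -sumrMnl; apply: eq_bigr => j _.
rewrite raddfMn -mulrnA divnK //.
by apply: prime_dvd_bin => //=; rewrite !ltnS.
Qed.

(** The p-th power replaces 1 + x by 1 + p (x + t x), and p ^ i kills
    p (x + t x) if and only if it kills p x, because 1 + t is invertible. *)
Lemma one_plus_expp_eq1 (N : finNilComRingType) p :
    prime p -> (forall x : N, exists w, iter p.-2 (nmul x) x = w *+ p) ->
  forall i (x : N), ((OnePlus x ^+ (p ^ i))%g == 1%g) = (x *+ (p ^ i) == 0).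
Proof.
move=> p_pr divp; elim=> [|i IHi] x; first by rewrite expn0 expg1 mulr1n.
have [w xp] := divp x; have [t xpt] := one_plus_expp p_pr xp.
rewrite expnS expgM xpt IHi -mulrnA mulrnDl -raddfMn.
apply/eqP/eqP=> [/addr_nmul_eq0 // | ->]; by rewrite raddf0 addr0.
Qed.

Lemma has_rank_span (D : comNzRingType) (M : finLmodType D) r :
    has_rank M r ->
  exists e : 'I_r -> M, forall y, exists a : 'I_r -> D, y = \sum_i a i *: e i.
Proof.
case=> C [cyclicC _ sumC]; have [e defC] := fin_all_exists cyclicC.
exists e => y; have [g [[Cg ->] _]] := sumC y.
have [a defg] := fin_all_exists (fun i => (defC i (g i)).1 (Cg i)).
by exists a; apply: eq_bigr => i _; rewrite defg.
Qed.

(** * The isomorphism *)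

Local Open Scope group_scope.

Theorem corollary4p3 (p k r : nat) (D : idomainType) (N : finNilComAlgType D) :
    prime p -> #|N| = (p ^ k)%N ->
    principal_ideal_domain D -> prime_element (p%:R : D)%R ->
    has_rank N r -> (r < p - 1)%N ->
  [set: one_plus N] \isog [set: (N : finZmodType)].
Proof.
move=> p_pr cardN pidD p_prime /has_rank_span[e span_e] lt_rp.
have divp (x : N) : exists w, iter p.-2 (nmul x) x = (w *+ p)%R.
  have [w def_w] := iter_nmul_divisible x x pidD p_prime span_e.
  have le_rp: (r <= p.-2)%N by move: lt_rp; rewrite subn1; case: p.-1.
  exists (iter (p.-2 - r) (nmul x) w).
  by rewrite -{1}(subnK le_rp) iterD def_w iter_nmulMn.
have pN: p.-group [set: (N : finZmodType)].
  by rewrite /pgroup cardsT cardN pnatX pnat_id.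
have card1N: #|[set: one_plus N]| = #|N|.
  rewrite cardsT; apply: (bij_eq_card (f := @one_plus_val N)).
  by exists (@OnePlus N) => // -[].
apply: (isog_abelian_pgroup p_pr) => //.
- apply/centsP=> -[x] _ [y] _; congr OnePlus.
  by rewrite (addrC x) nmulC.
- exact: FinRing.zmod_abelian.
- by rewrite /pgroup card1N cardN pnatX pnat_id.
move=> n; rewrite -(card_imset _ (f := @one_plus_val N)); last exact: val_inj.
apply: eq_card => x; apply/imsetP/LdivP => [[[y] /LdivP[_ y1] ->]|[_ x1]].
  split; rewrite ?inE //; apply/eqP.
  by rewrite -(one_plus_expp_eq1 p_pr divp) y1.
exists (OnePlus x) => //; apply/LdivP; split; rewrite ?inE //.
by apply/eqP; rewrite (one_plus_expp_eq1 p_pr divp); apply/eqP.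
Qed.
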